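(* Let $H$ be an infinite dimensional separable complex Hilbert space and $V=B(H)_{sa}$. The action of $\mathcal U(H)$ on $\mathrm{Aut}(V)$ given by $u\cdot k=\mathrm{Ad}_u\circ k$ has smooth local cross-sections: for any $k_0\in\mathrm{Aut}(V)$ there exist an open neighbourhood $N$ of $k_0$ in $\mathrm{Aut}(V)$ and a smooth map $s:N\to\mathcal U(H)$ such that $s(k_0)=1$ and $\mathrm{Ad}_{s(k)}\circ k_0=k$ for all $k\in N$.
   Context: $V=B(H)_{sa}$ is the real Banach space of bounded self-adjoint operators on $H$ with operator norm and Jordan product $A\circ B=\frac12(AB+BA)$. $\mathrm{Aut}(V)$ is the group of bounded invertible real-linear $k:V\to V$ with $k(A\circ B)=k(A)\circ k(B)$ (product of elements of $V$); it is an embedded Banach-Lie subgroup of the group $GL(V)$ of bounded invertible operators of $V$ (norm topology). $\mathcal U(H)$ is the unitary group of $H$, a Banach-Lie group with the operator norm. $\mathrm{Ad}_u\in\mathrm{Aut}(V)$ is $\mathrm{Ad}_u(A)=uAu^\dagger$, with $\dagger$ the Hilbert space adjoint, so $(u\cdot k)(A)=u\,k(A)\,u^\dagger$. *)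

(* Defs.v *)
From HB Require Import structures.
From mathcomp Require Import all_boot all_order all_algebra.
From mathcomp Require Import complex.
From mathcomp Require Import all_classical all_reals all_analysis.

Set Implicit Arguments.
Unset Strict Implicit.
Unset Printing Implicit Defensive.

Import Order.TTheory GRing.Theory Num.Def Num.Theory.
Import numFieldNormedType.Exports.

Local Open Scope classical_set_scope.
Local Open Scope ring_scope.

Section BoundedLinear.
Context {R : realType} (E F : normedModType R).

Definition bounded_linear : {pred E -> F} :=
  fun f => `[< linear f /\ continuous f >].

Structure BL := MkBL { blfun :> E -> F; blfunP : blfun \in bounded_linear }.

HB.instance Definition _ := [isSub of BL for blfun].
HB.instance Definition _ := [Choice of BL by <:].

Lemma bounded_linear_submod : submod_closed bounded_linear.
Proof.
split=> [|a f g].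
  by apply/asboolP; split=> [a x y|x] /=; [rewrite scaler0 addr0|exact: cvg_cst].
move=> /asboolP[fl fc] /asboolP[gl gc]; apply/asboolP; split=> [b x y|x].
  rewrite /= !fctE fl gl !scalerDr !scalerA (mulrC b).
  by rewrite addrACA.
by apply: cvgD; [apply: cvgZl_tmp; exact: fc|exact: gc].
Qed.
HB.instance Definition _ :=
  GRing.isSubmodClosed.Build R (E -> F) bounded_linear bounded_linear_submod.
HB.instance Definition _ := [SubChoice_isSubLmodule of BL by <:].

Lemma BL_linear (f : BL) : linear f.
Proof. by case: f => f /= /asboolP[]. Qed.
HB.instance Definition _ (f : BL) :=
  GRing.isLinear.Build R E F *:%R (blfun f) (BL_linear f).

Lemma BL_continuous (f : BL) : continuous f.
Proof. by case: f => f /= /asboolP[]. Qed.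

Lemma BLP (f g : BL) : f =1 g -> f = g.
Proof. by move=> fg; apply: val_inj; apply/funext. Qed.

Definition opnorm (f : BL) : R := sup [set `|f x| | x in [set x | `|x| <= 1]].

Lemma BL_bound (f : BL) : exists2 M, 0 <= M & forall x, `|f x| <= M * `|x|.
Proof.
have : bounded_near f (nbhs 0).
  by apply/linear_bounded_continuous; exact: BL_continuous.
by move=> /linear_boundedP/pinfty_ex_gt0[M M0 fM]; exists M => //; exact: ltW.
Qed.

Lemma opnorm_has_sup (f : BL) : has_sup [set `|f x| | x in [set x | `|x| <= 1]].
Proof.
split; first by exists `|f 0|, 0 => //=; rewrite normr0.
have [M M0 fM] := BL_bound f; exists M => _ [x /= x1 <-].
by rewrite (le_trans (fM x))// ler_piMr.
Qed.

Lemma opnorm_ub (f : BL) x : `|x| <= 1 -> `|f x| <= opnorm f.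
Proof.
move=> x1; apply: sup_upper_bound; first exact: opnorm_has_sup.
by exists x.
Qed.

Lemma opnorm_le (f : BL) M :
  (forall x, `|x| <= 1 -> `|f x| <= M) -> opnorm f <= M.
Proof.
move=> fM; apply: ge_sup; first by case: (opnorm_has_sup f).
by move=> _ [x /= x1 <-]; exact: fM.
Qed.

Lemma opnorm_ge0 (f : BL) : 0 <= opnorm f.
Proof. by rewrite (le_trans _ (@opnorm_ub f 0 _))// normr0. Qed.

Lemma opnormD (f g : BL) : opnorm (f + g) <= opnorm f + opnorm g.
Proof.
apply: opnorm_le => x x1.
by rewrite (le_trans (ler_normD _ _))// lerD// opnorm_ub.
Qed.

Lemma opnormZ (l : R) (f : BL) : opnorm (l *: f) = `|l| * opnorm f.
Proof.
have le k (g : BL) : opnorm (k *: g) <= `|k| * opnorm g.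
  by apply: opnorm_le => x x1; rewrite normrZ ler_wpM2l// opnorm_ub.
apply/eqP; rewrite eq_le le /=.
have [->|l0] := eqVneq l 0; first by rewrite normr0 mul0r opnorm_ge0.
by rewrite -ler_pdivlMl ?normr_gt0// -normfV (le_trans _ (le _ _))// scalerK.
Qed.

Lemma opnorm_eq0 (f : BL) : opnorm f = 0 -> f = 0.
Proof.
move=> f0; apply: BLP => x.
have [->|x0] := eqVneq x 0; first exact: linear0.
have nx0 : `|x| != 0 by rewrite normr_eq0.
have : `|f (`|x|^-1 *: x)| <= 0.
  by rewrite -f0 opnorm_ub// normrZ normfV normr_id mulVf.
rewrite normr_le0 linearZ scaler_eq0 invr_eq0 (negbTE nx0) /=.
by move=> /eqP.
Qed.

HB.instance Definition _ :=
  @Lmodule_isNormed.Build R BL opnorm opnormD opnormZ opnorm_eq0.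

End BoundedLinear.


(* Iterated Frechet differentiability: the derivative Df is again required to
   be C^m as a map into the normed space BL E F. *)
Fixpoint is_Ck (R : realType) (E : normedModType R) (n : nat)
    (F : normedModType R) (W : set E) (f : E -> F) {struct n} : Prop :=
  if n is m.+1 then
    (forall x, W x -> differentiable f x) /\
    exists2 Df : E -> BL E F,
      (forall x, W x -> Df x =1 'd f x) & is_Ck m W Df
  else forall x, W x -> {for x, continuous f}.

Definition smooth_open (R : realType) (E F : normedModType R)
    (W : set E) (f : E -> F) : Prop :=
  open W /\ forall n, is_Ck n W f.

(* Smoothness on a subset M of a normed space: f is locally the restriction of a
   smooth map on an open set of the ambient space.  For a split embedded
   submanifold M this is smoothness in the submanifold charts. *)
Definition smooth_on (R : realType) (E F : normedModType R)
    (M : set E) (f : E -> F) : Prop :=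
  forall p, M p -> exists W (g : E -> F),
    [/\ W p, smooth_open W g & forall x, M x -> W x -> g x = f x].

(* The real normed space underlying a complex one: same vectors, scalars
   restricted to R, and the (real) norm read in R instead of R[i]. *)
Definition realified (R : realType) (E : normedModType R[i]) : Type := E.

Section Realified.
Context {R : realType} (E : normedModType R[i]).
Local Notation ER := (realified E).

HB.instance Definition _ := GRing.Zmodule.on ER.

Definition realified_scale (r : R) (x : ER) : ER := (r%:C)%C *: (x : E).

Lemma realified_scaleA a b x :
  realified_scale a (realified_scale b x) = realified_scale (a * b) x.
Proof. by rewrite /realified_scale scalerA -rmorphM. Qed.
Lemma realified_scale1 : left_id 1 realified_scale.
Proof. by move=> x; rewrite /realified_scale rmorph1 scale1r. Qed.
Lemma realified_scaleDr : right_distributive realified_scale +%R.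
Proof. by move=> a x y; rewrite /realified_scale scalerDr. Qed.
Lemma realified_scaleDl x : {morph realified_scale^~ x : a b / a + b}.
Proof. by move=> a b; rewrite /realified_scale rmorphD scalerDl. Qed.

HB.instance Definition _ := GRing.Zmodule_isLmodule.Build R ER
  realified_scaleA realified_scale1 realified_scaleDr realified_scaleDl.

Definition realified_norm (x : ER) : R := complex.Re `|x : E|.

Lemma realified_normE (x : ER) : ((realified_norm x)%:C)%C = `|x : E|.
Proof. by rewrite RRe_real// normr_real. Qed.
Lemma realified_normD x y :
  realified_norm (x + y) <= realified_norm x + realified_norm y.
Proof.
by rewrite -lecR rmorphD /= !realified_normE; exact: (@ler_normD _ E).
Qed.
Lemma realified_normZ (r : R) x :
  realified_norm (r *: x) = `|r| * realified_norm x.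
Proof.
apply: complexI; rewrite rmorphM /= !realified_normE.
rewrite (@normrZ _ E) normc_def /= expr0n addr0 sqrtr_sqr.
by [].
Qed.
Lemma realified_norm_eq0 x : realified_norm x = 0 -> x = 0.
Proof.
move=> x0; apply: (@normr0_eq0 _ E); rewrite -realified_normE x0.
by [].
Qed.

HB.instance Definition _ := @Lmodule_isNormed.Build R ER realified_norm
  realified_normD realified_normZ realified_norm_eq0.
End Realified.

(* Bounded complex-linear operators on H.  The codomain realified H is H itself;
   it gives bop the structure of a real vector space. *)
Section BoundedOperators.
Context {R : realType} (H : normedModType R[i]).

Definition bounded_operator : {pred H -> realified H} :=
  fun f => `[< linear (f : H -> H) /\ continuous (f : H -> H) >].

Structure bop := MkBop
  { bop_fun : H -> realified H; bop_funP : bop_fun \in bounded_operator }.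

Definition bop_app (A : bop) : H -> H := bop_fun A.
Coercion bop_app : bop >-> Funclass.

HB.instance Definition _ := [isSub of bop for bop_fun].
HB.instance Definition _ := [Choice of bop by <:].

Lemma bounded_operator_submod : submod_closed bounded_operator.
Proof.
split=> [|a f g].
  by apply/asboolP; split=> [a x y|x]; [rewrite /= scaler0 addr0|exact: cvg_cst].
move=> /asboolP[fl fc] /asboolP[gl gc]; apply/asboolP; split=> [b x y|x].
  rewrite [LHS]/(_ + _) /=.
  change (((a%:C)%C *: (f (b *: x + y) : H)) + g (b *: x + y) =
    b *: ((a%:C)%C *: (f x : H) + (g x : H)) + ((a%:C)%C *: (f y : H) + g y)).
  by rewrite fl gl !scalerDr !scalerA (mulrC b) addrACA.
change ((fun z => (a%:C)%C *: (f z : H) + (g z : H)) @ x -->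
  ((a%:C)%C *: (f x : H) + (g x : H))).
by apply: cvgD; [apply: cvgZl_tmp; exact: fc|exact: gc].
Qed.
HB.instance Definition _ :=
  GRing.isSubmodClosed.Build R (H -> realified H) bounded_operator
    bounded_operator_submod.
HB.instance Definition _ := [SubChoice_isSubLmodule of bop by <:].

Lemma bop_linear (A : bop) : linear A.
Proof. by case: A => f /= /asboolP[]. Qed.

HB.instance Definition _ (A : bop) :=
  GRing.isLinear.Build R[i] H H *:%R (bop_app A) (bop_linear A).

Lemma bop_continuous (A : bop) : continuous A.
Proof. by case: A => f /= /asboolP[]. Qed.

Lemma bopP (A B : bop) : A =1 B -> A = B.
Proof. by move=> AB; apply: val_inj; apply/funext. Qed.

Lemma bopDE (A B : bop) x : (A + B) x = A x + B x.
Proof. by []. Qed.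
Lemma bopZE (r : R) (A : bop) x : (r *: A) x = (r%:C)%C *: A x.
Proof. by []. Qed.

Definition bop_of (f : H -> H) (fl : linear f) (fc : continuous f) : bop :=
  @MkBop f (asboolT (conj fl fc)).

Lemma bop1_linear : linear (@id H). Proof. by []. Qed.
Lemma bop1_continuous : continuous (@id H). Proof. by move=> x; exact: cvg_id. Qed.
Definition bop1 : bop := bop_of bop1_linear bop1_continuous.

Lemma bop_comp_linear (A B : bop) : linear (A \o B).
Proof. by move=> a x y; rewrite /= !linearP. Qed.
Lemma bop_comp_continuous (A B : bop) : continuous (A \o B).
Proof.
by move=> x; apply: continuous_comp; exact: bop_continuous.
Qed.
Definition bop_comp (A B : bop) : bop :=
  bop_of (@bop_comp_linear A B) (@bop_comp_continuous A B).

Lemma bop_real_subproof (A : bop) :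
  (bop_app A : realified H -> realified H) \in
  @bounded_linear R (realified H) (realified H).
Proof.
have Al : linear (bop_app A : realified H -> realified H).
  by move=> a x y; exact: (bop_linear A).
apply/asboolP; split => //.
pose g : {linear realified H -> realified H} :=
  HB.pack (bop_app A : realified H -> realified H)
    (GRing.isLinear.Build _ _ _ _ _ Al).
apply: (@bounded_linear_continuous _ _ _ g); apply/linear_boundedP.
have : bounded_near A (nbhs (0 : H)).
  by apply/linear_bounded_continuous; exact: bop_continuous.
move=> /linear_boundedP/pinfty_ex_gt0[M M0 AM].
near=> r => x.
rewrite -lecR rmorphM /= !realified_normE (le_trans (AM x))// ler_wpM2r//.
rewrite -(RRe_real (gtr0_real M0)) lecR.
near: r; apply: nbhs_pinfty_ge; exact: num_real.
Unshelve. all: by end_near. Qed.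

Definition bop_real (A : bop) : BL (realified H) (realified H) :=
  MkBL (bop_real_subproof A).

(* Since realified H has the same norm as H, this is the usual operator norm. *)
Definition bop_norm (A : bop) : R := `|bop_real A|.

Lemma bop_normD (A B : bop) : bop_norm (A + B) <= bop_norm A + bop_norm B.
Proof.
rewrite /bop_norm (_ : bop_real (A + B) = bop_real A + bop_real B).
  exact: ler_normD.
exact: BLP.
Qed.
Lemma bop_normZ (l : R) (A : bop) : bop_norm (l *: A) = `|l| * bop_norm A.
Proof.
rewrite /bop_norm (_ : bop_real (l *: A) = l *: bop_real A).
  exact: normrZ.
exact: BLP.
Qed.
Lemma bop_norm_eq0 (A : bop) : bop_norm A = 0 -> A = 0.
Proof.
move=> /normr0_eq0 A0; apply: bopP => x.
by have := congr1 (fun f : BL (realified H) (realified H) => f (x : realified H)) A0.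
Qed.

HB.instance Definition _ := @Lmodule_isNormed.Build R bop bop_norm
  bop_normD bop_normZ bop_norm_eq0.
End BoundedOperators.

(* inner is linear in its first argument and conjugate-linear in the second. *)
HB.mixin Record CompleteNormedModule_isHilbert (R : realType) H
    & CompleteNormedModule R[i] H := {
  inner : {dot H for @Num.conj R[i]};
  inner_norm : forall x : H, `|x| ^+ 2 = inner x x
}.

#[short(type="hilbertType")]
HB.structure Definition Hilbert (R : realType) :=
  {H of CompleteNormedModule R[i] H & CompleteNormedModule_isHilbert R H}.

Definition infinite_dimensional (K : fieldType) (E : lmodType K) : Prop :=
  ~ exists n (e : 'I_n -> E), forall x, exists c : 'I_n -> K,
      x = \sum_i c i *: e i.

Definition separable (T : topologicalType) : Prop :=
  exists2 D : set T, countable D & dense D.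

Section Hilbert.
Context {R : realType} (H : hilbertType R).

Definition is_adjoint (A B : bop H) : Prop :=
  forall x y, inner (A x) y = inner x (B y).

(* The adjoint exists by the Riesz representation theorem, and is unique. *)
Definition adjoint (A : bop H) : bop H := get (is_adjoint A).

Definition unitary (u : bop H) : Prop :=
  bop_comp u (adjoint u) = bop1 H /\ bop_comp (adjoint u) u = bop1 H.

Definition self_adjoint : {pred bop H} := fun A => `[< is_adjoint A A >].

Structure bop_sa := MkBopSa { sa_bop :> bop H; sa_bopP : sa_bop \in self_adjoint }.

HB.instance Definition _ := [isSub of bop_sa for sa_bop].
HB.instance Definition _ := [Choice of bop_sa by <:].

Lemma inner_realZl (a : R) (x y : H) :
  inner ((a%:C)%C *: x) y = (a%:C)%C * inner x y.
Proof. by rewrite linearZl_LR. Qed.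
Lemma inner_realZr (a : R) (x y : H) :
  inner x ((a%:C)%C *: y) = (a%:C)%C * inner x y.
Proof. by rewrite linearZr_LR /= conj_Creal// complex_real. Qed.
Lemma inner_bopDl (A B : bop H) x y :
  inner ((A + B) x) y = inner (A x) y + inner (B x) y.
Proof. by rewrite bopDE linearDl. Qed.
Lemma inner_bopDr (A B : bop H) x y :
  inner x ((A + B) y) = inner x (A y) + inner x (B y).
Proof. by rewrite bopDE linearDr. Qed.
Lemma inner_bopZl (a : R) (A : bop H) x y :
  inner ((a *: A) x) y = (a%:C)%C * inner (A x) y.
Proof. by rewrite bopZE; exact: inner_realZl. Qed.
Lemma inner_bopZr (a : R) (A : bop H) x y :
  inner x ((a *: A) y) = (a%:C)%C * inner x (A y).
Proof. by rewrite bopZE; exact: inner_realZr. Qed.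

Lemma self_adjoint_submod : submod_closed self_adjoint.
Proof.
split=> [|a A B].
  by apply/asboolP=> x y; rewrite linear0r linear0l.
move=> /asboolP Asa /asboolP Bsa; apply/asboolP => x y.
by rewrite inner_bopDl inner_bopDr inner_bopZl inner_bopZr Asa Bsa.
Qed.
HB.instance Definition _ :=
  GRing.isSubmodClosed.Build R (bop H) self_adjoint self_adjoint_submod.
HB.instance Definition _ := [SubChoice_isSubLmodule of bop_sa by <:].

Definition sa_norm (A : bop_sa) : R := `|sa_bop A|.

Lemma sa_normD (A B : bop_sa) : sa_norm (A + B) <= sa_norm A + sa_norm B.
Proof. exact: ler_normD. Qed.
Lemma sa_normZ (l : R) (A : bop_sa) : sa_norm (l *: A) = `|l| * sa_norm A.
Proof. exact: normrZ. Qed.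
Lemma sa_norm_eq0 (A : bop_sa) : sa_norm A = 0 -> A = 0.
Proof. by move=> /normr0_eq0 A0; exact: val_inj. Qed.

HB.instance Definition _ := @Lmodule_isNormed.Build R bop_sa sa_norm
  sa_normD sa_normZ sa_norm_eq0.

Lemma jordan_subproof (A B : bop_sa) :
  2^-1 *: (bop_comp A B + bop_comp B A) \in self_adjoint.
Proof.
apply/asboolP => x y; have /asboolP Asa := sa_bopP A.
have /asboolP Bsa := sa_bopP B.
rewrite inner_bopZl inner_bopZr inner_bopDl inner_bopDr addrC.
by congr (_ * (_ + _)); [rewrite [LHS]Bsa [LHS]Asa|rewrite [LHS]Asa [LHS]Bsa].
Qed.

Definition jordan (A B : bop_sa) : bop_sa := MkBopSa (jordan_subproof A B).

Definition jordan_aut : set (BL bop_sa bop_sa) := [set k : BL bop_sa bop_sa |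
  (exists k' : BL bop_sa bop_sa, cancel k k' /\ cancel k' k) /\
  forall A B, k (jordan A B) = jordan (k A) (k B)].

Definition Ad (u A : bop H) : bop H := bop_comp u (bop_comp A (adjoint u)).

End Hilbert.
Arguments jordan_aut {R} H.

Definition relatively_open (T : topologicalType) (M N : set T) : Prop :=
  exists2 W : set T, open W & N = M `&` W.

(* Main.v *)
(* Fix a unit vector e, put P = |e><e| and S_x = |x><e| + |e><x|, and let
   alpha = k k0^-1, a Jordan automorphism near the identity.  If alpha = Ad_u,
   then T x = (alpha(S_x) e - i alpha(S_{ix}) e) / 2 equals <e, u e> u x, so that
   s(k) = <alpha(P) e, e>^(-1/2) T is u up to a phase, equals 1 at k0, and is
   smooth in k: T is linear in k, and the scalar factor is a power of a linear
   functional which is positive near k0.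

   That a Jordan automorphism near the identity is of this form is shown
   directly.  As Q = alpha(P) satisfies Q B Q = lambda Q for all B, it is the
   projection onto the line of g = Q e.  For x orthogonal to e set
   w(x) = alpha(S_x) g; then alpha(S_x) and alpha(|x><x|) are determined by g and
   w(x).  Since |ix><ix| = |x><x|, this forces w(ix) = i w(x) or
   w(ix) = - i w(x), and closeness to the identity excludes the second case, the
   one of antiunitaries.  Hence alpha(|x><x|) is proportional to |Tx><Tx| for
   all x, and the identity |x><x| A |x><x| = <A x, x> |x><x| yields, by
   polarization, <alpha(A) T x, T y> = <g, g> <A x, y>. *)
Require Import Defs.
From HB Require Import structures.
From mathcomp Require Import all_boot all_order all_algebra.
From mathcomp Require Import complex.
From mathcomp Require Import ring lra.
From mathcomp Require Import all_classical all_reals all_analysis.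

Set Implicit Arguments.
Unset Strict Implicit.
Unset Printing Implicit Defensive.

Import Order.TTheory GRing.Theory Num.Theory.
Import numFieldNormedType.Exports.

Local Open Scope classical_set_scope.
Local Open Scope ring_scope.

(** * Bounded linear maps from norm estimates *)

Section BLConstruction.
Context {R : realType} {E F : normedModType R}.

Lemma bounded_linearP {f : E -> F} {M : R} :
  linear f -> (forall x, `|f x| <= M * `|x|) -> f \in @bounded_linear R E F.
Proof.
move=> fl fM; apply/asboolP; split => //.
pose g : {linear E -> F} := HB.pack f (GRing.isLinear.Build _ _ _ _ _ fl).
apply: (@bounded_linear_continuous _ _ _ g); apply/linear_boundedP.
near=> r => x; rewrite (le_trans (fM x))// ler_wpM2r//.
Unshelve. all: by end_near. Qed.

Lemma BL_le (f : BL E F) x : `|f x| <= `|f| * `|x|.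
Proof.
have [->|x0] := eqVneq x 0; first by rewrite linear0 !normr0 mulr0.
have nx0 : 0 < `|x| by rewrite normr_gt0.
rewrite -ler_pdivrMr// mulrC -[X in X * _]gtr0_norm ?invr_gt0// -normrZ -linearZ.
by apply: opnorm_ub; rewrite normrZ normfV normr_id mulVf// gt_eqF.
Qed.

Lemma BL_norm_le (f : BL E F) M :
  0 <= M -> (forall x, `|f x| <= M * `|x|) -> `|f| <= M.
Proof.
move=> M0 fM; apply: opnorm_le => x x1.
by rewrite (le_trans (fM x))// ler_piMr.
Qed.

Lemma BLDE (f g : BL E F) x : (f + g) x = f x + g x. Proof. by []. Qed.
Lemma BLZE a (f : BL E F) x : (a *: f) x = a *: f x. Proof. by []. Qed.
End BLConstruction.

(** * Rank-one maps [h |-> phi h *: c], the building blocks of the derivatives *)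

Section Tensor.
Context {R : realType} {E F : normedModType R}.
Variables (phi : BL E R) (L : BL E F).

Lemma BL_tensor_linear (c : F) : linear (fun h => phi h *: c).
Proof. by move=> a x y; rewrite linearP scalerDl scalerA. Qed.
Lemma BL_tensor_bound (c : F) x : `|phi x *: c| <= (`|phi| * `|c|) * `|x|.
Proof. by rewrite normrZ [leRHS]mulrAC ler_wpM2r// BL_le. Qed.
Definition BL_tensor (c : F) : BL E F :=
  MkBL (bounded_linearP (BL_tensor_linear c) (BL_tensor_bound c)).

Lemma BL_tensor_comp_linear : linear (fun k => BL_tensor (L k)).
Proof.
by move=> a x y; apply: BLP => h; rewrite BLDE BLZE /= linearP scalerDr !scalerA mulrC.
Qed.
Lemma BL_tensor_comp_bound k : `|BL_tensor (L k)| <= (`|phi| * `|L|) * `|k|.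
Proof.
apply: BL_norm_le => [|x]; first by rewrite !mulr_ge0.
rewrite (le_trans (BL_tensor_bound _ _))// ler_wpM2r// -mulrA ler_wpM2l//.
exact: BL_le.
Qed.
Definition BL_tensor_comp : BL E (BL E F) :=
  MkBL (bounded_linearP BL_tensor_comp_linear BL_tensor_comp_bound).
End Tensor.

(** * Smoothness of a power of a functional times an affine map *)

Section Smoothness.
Context {R : realType} {E : normedModType R}.

Lemma is_CkD n (F : normedModType R) (W : set E) (f g : E -> F) :
  is_Ck n W f -> is_Ck n W g -> is_Ck n W (f + g).
Proof.
elim: n F f g => [|n IH] F f g /=.
  by move=> cf cg x Wx; apply: cvgD; [exact: cf|exact: cg].
move=> [df [Df Dfd CDf]] [dg [Dg Dgd CDg]]; split.
  by move=> x Wx; apply: differentiableD; [exact: df|exact: dg].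
exists (Df + Dg); last exact: IH.
move=> x Wx h; rewrite diffD; [|exact: df|exact: dg].
by rewrite -[LHS]/(Df x h + Dg x h) Dfd// Dgd.
Qed.

Lemma scale_bilinear (F : normedModType R) :
  bilinear_for (GRing.Scale.Law.clone _ _ *:%R _)
    (GRing.Scale.Law.clone _ _ *:%R _) (@GRing.scale R F : R -> F -> F).
Proof.
split=> [u'|u] a x y /=; first by rewrite scalerDl scalerA.
by rewrite scalerDr !scalerA mulrC.
Qed.
HB.instance Definition _ (F : normedModType R) :=
  bilinear_isBilinear.Build R R F F _ _ (@GRing.scale R F) (scale_bilinear F).

(** Chain rule through the pair [(u, f)] and scaling, which is continuous and bilinear. *)
Lemma is_diff_scale (F : normedModType R) (u du : E -> R) (f df : E -> F) x :
  is_diff x u du -> is_diff x f df ->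
  is_diff x (fun y => u y *: f y) (fun y => u x *: df y + du y *: f x).
Proof.
move=> ud fd; have pd := is_diff_pair ud fd.
have sd : is_diff (u x, f x) (fun q : R * F => q.1 *: q.2)
    (fun q => u x *: q.2 + q.1 *: f x).
  apply: DiffDef; last by rewrite diff_bilin // => ?; apply: scale_continuous.
  by apply: differentiable_bilin => ?; apply: scale_continuous.
exact: (@is_diff_comp _ _ _ _ (fun y => (u y, f y)) _ (fun q => q.1 *: q.2)).
Qed.

Lemma is_diff_powR (phi : BL E R) a x : 0 < phi x ->
  is_diff x (fun k => phi k `^ a) (fun h => (a * phi x `^ (a - 1)) * phi h).
Proof.
move=> phix.
have d : is_diff (phi x) (fun t : R => t `^ a)
    (fun h : R => h *: (a * phi x `^ (a - 1))).
  have dp := is_derive1_powR a phix.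
  have d : derivable (fun t : R => t `^ a) (phi x) 1 by [].
  apply: DiffDef; first exact/derivable1_diffP.
  by rewrite deriv1E// derive1E; case: dp => _ ->.
have pd : is_diff x phi phi.
  apply: DiffDef; first exact/linear_differentiable/BL_continuous.
  exact/diff_lin/BL_continuous.
have [cd cE] := is_diff_comp pd d; apply: DiffDef; first exact: cd.
by rewrite [LHS]cE; apply/funext => h; exact: (mulrC (phi h)).
Qed.

Lemma is_diff_affine (F : normedModType R) (L : BL E F) c x :
  is_diff x (fun k => L k + c) L.
Proof.
have Ld : is_diff x L L.
  apply: DiffDef; first exact/linear_differentiable/BL_continuous.
  exact/diff_lin/BL_continuous.
have [cd cE] := is_diffD Ld (is_diff_cst c x); apply: DiffDef; first exact: cd.
by rewrite [LHS]cE addr0.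
Qed.

(* The family of maps [k |-> phi k ^ a *: (L k + c)] is closed under
   differentiation up to sums, which makes the induction go through. *)
Lemma is_Ck_powR_scale (phi : BL E R) (W : set E) n :
  (forall x, W x -> 0 < phi x) ->
  forall (F : normedModType R) (L : BL E F) (c : F) a,
  is_Ck n W (fun k => phi k `^ a *: (L k + c)).
Proof.
move=> phiW.
have D F (L : BL E F) c a x (Wx : W x) :=
  is_diff_scale (is_diff_powR a (phiW _ Wx)) (is_diff_affine L c x).
elim: n => [|n IH] F L c a.
  by move=> x Wx; have [d _] := D F L c a x Wx; exact: differentiable_continuous d.
split=> [x Wx|]; first by have [] := D F L c a x Wx.
(* Differentiating the power lowers the exponent and leaves an affine map into [BL E F];
   differentiating [L k + c] leaves the constant [L], given a zero linear part so as to stay in the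
   family. *)
exists ((fun k => phi k `^ (a - 1) *: ((a *: BL_tensor_comp phi L) k + a *: BL_tensor phi c))
   + (fun k => phi k `^ a *: ((0 : BL E (BL E F)) k + L))); last by apply: is_CkD; exact: IH.
move=> x Wx h; have [_ ->] := D F L c a x Wx.
rewrite -[LHS]/(phi x `^ (a - 1) *: (a *: (phi h *: L x) + a *: (phi h *: c)) + phi x `^ a *: (0 + L h)).
rewrite add0r addrC; congr (_ + _).
by rewrite -!scalerDr !scalerA; congr (_ *: _); ring.
Qed.
End Smoothness.

(** * Inner product calculus and rank-one operators *)

Section InnerProduct.
Context {R : realType} {H : hilbertType R}.
Implicit Types (x y z : H) (a : R[i]).

Definition hnorm x : R := realified_norm x.

Lemma hnormE x : ((hnorm x)%:C)%C = `|x|. Proof. exact: realified_normE. Qed.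
Lemma hnorm_ge0 x : 0 <= hnorm x.
Proof. by rewrite -[0 <= _]lecR hnormE normr_ge0. Qed.
Lemma ler_hnormD x y : hnorm (x + y) <= hnorm x + hnorm y.
Proof. exact: realified_normD. Qed.
Lemma hnormZ (r : R) x : hnorm ((r%:C)%C *: x) = `|r| * hnorm x.
Proof. exact: (@realified_normZ R H r x). Qed.
Lemma hnormZ1 a x : `|a| = 1 -> hnorm (a *: x) = hnorm x.
Proof. by move=> a1; apply: complexI; rewrite !hnormE normrZ a1 mul1r. Qed.
Lemma hnormN x : hnorm (- x) = hnorm x.
Proof. by apply: complexI; rewrite !hnormE normrN. Qed.
Lemma hnorm_eq0 x : hnorm x = 0 -> x = 0.
Proof. by move=> x0; apply: normr0_eq0; rewrite -hnormE x0. Qed.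

Lemma innerC x y : inner x y = (inner y x)^*.
Proof. by rewrite hermC /= expr0 mul1r. Qed.
Lemma innerDl x y z : inner (x + y) z = inner x z + inner y z.
Proof. exact: linearDl. Qed.
Lemma innerDr x y z : inner x (y + z) = inner x y + inner x z.
Proof. exact: linearDr. Qed.
Lemma innerNl x y : inner (- x) y = - inner x y.
Proof. exact: linearNl. Qed.
Lemma innerNr x y : inner x (- y) = - inner x y.
Proof. exact: linearNr. Qed.
Lemma innerZl a x y : inner (a *: x) y = a * inner x y.
Proof. exact: linearZl_LR. Qed.
Lemma innerZr a x y : inner x (a *: y) = a^* * inner x y.
Proof. exact: linearZr_LR. Qed.
Lemma inner0l x : inner 0 x = 0. Proof. exact: linear0l. Qed.
Lemma inner0r x : inner x 0 = 0. Proof. exact: linear0r. Qed.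
Definition innerE := (innerDl, innerDr, innerNl, innerNr, innerZl, innerZr,
  inner0l, inner0r).

Lemma conj_real (r : R) : ((r%:C)%C)^* = (r%:C)%C.
Proof. by rewrite conj_Creal// complex_real. Qed.

Lemma innerxx x : inner x x = ((hnorm x ^+ 2)%:C)%C.
Proof. by rewrite -inner_norm rmorphXn /= hnormE. Qed.

Lemma conj_innerxx x : (inner x x)^* = inner x x.
Proof. by rewrite -innerC. Qed.

Lemma inner_eq0 x : inner x x = 0 -> x = 0.
Proof.
rewrite innerxx => x0; apply/hnorm_eq0/eqP.
by rewrite -sqrf_eq0; apply/eqP/complexI.
Qed.

Lemma hnorm_unit e : inner e e = 1 -> hnorm e = 1.
Proof.
move=> e1; apply: complexI; rewrite hnormE; apply/eqP.
by rewrite -sqrp_eq1// inner_norm e1.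
Qed.

Lemma inner_ext x y : (forall z, inner x z = inner y z) -> x = y.
Proof.
move=> xy; apply/eqP; rewrite -subr_eq0; apply/eqP/inner_eq0.
by rewrite innerDl innerNl xy subrr.
Qed.

Lemma CauchySchwarz x y : `|inner x y| <= `|x| * `|y|.
Proof.
have [->|y0] := eqVneq y 0; first by rewrite inner0r !normr0 mulr0.
have N0 : 0 < inner y y by rewrite -inner_norm exprn_gt0// normr_gt0.
(* This vector is <y,y> times the component of x orthogonal to y; its squared norm is <y,y>
   (<x,x><y,y> - |<x,y>|^2). *)
have : 0 <= inner (inner y y *: x - inner x y *: y)
                  (inner y y *: x - inner x y *: y).
  by rewrite -inner_norm exprn_ge0.
rewrite !innerE conj_innerxx (innerC y x).
rewrite (_ : _ + _ = inner y y * (inner x x * inner y y - inner x y * (inner x y)^*)).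
  rewrite pmulr_rge0// subr_ge0 -normCK -!inner_norm -exprMn.
  by rewrite ler_pXn2r// nnegrE// mulr_ge0.
by ring.
Qed.

Lemma bounded_bop_continuous (f : H -> H) (M : R) :
  linear f -> (forall x, hnorm (f x) <= M * hnorm x) -> continuous f.
Proof.
move=> fl fM.
pose g : {linear H -> H} := HB.pack f (GRing.isLinear.Build _ _ _ _ _ fl).
apply: (@bounded_linear_continuous _ _ _ g); apply/linear_boundedP.
near=> r => x; apply: (@le_trans _ _ ((M%:C)%C * `|x|)).
  by rewrite -!hnormE -rmorphM lecR.
by rewrite ler_wpM2r//; near: r; apply: nbhs_pinfty_ge; rewrite complex_real.
Unshelve. all: by end_near. Qed.

Definition bounded_bop (f : H -> H) (M : R) (fl : linear f)
  (fM : forall x, hnorm (f x) <= M * hnorm x) : bop H :=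
  bop_of fl (bounded_bop_continuous fl fM).

Lemma bop_le (A : bop H) x : hnorm (A x) <= `|A| * hnorm x.
Proof. exact: (BL_le (bop_real A) x). Qed.

Lemma bop_norm_le (A : bop H) M :
  0 <= M -> (forall x, hnorm (A x) <= M * hnorm x) -> `|A| <= M.
Proof. exact: (@BL_norm_le _ _ _ (bop_real A)). Qed.

Lemma rank1_linear x y : linear (fun z => inner z y *: x).
Proof. by move=> a u v; rewrite !innerE scalerDl scalerA. Qed.
Lemma rank1_bound x y z :
  hnorm (inner z y *: x) <= (hnorm y * hnorm x) * hnorm z.
Proof.
rewrite -lecR hnormE normrZ !rmorphM /= !hnormE mulrC -mulrA mulrCA ler_wpM2l//.
by rewrite mulrC CauchySchwarz.
Qed.
Definition rank1 x y : bop H := bounded_bop (rank1_linear x y) (rank1_bound x y).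
End InnerProduct.

(** * The operators |x><x| and |x><y| + |y><x|, and the Jordan triple product *)

Section SelfAdjoint.
Context {R : realType} {H : hilbertType R}.
Implicit Types (x y z : H) (A B : bop_sa H).

Lemma saP A B : (forall x, A x = B x) -> A = B.
Proof. by move=> AB; apply/val_inj/bopP. Qed.

Lemma sa_inner A x y : inner (A x) y = inner x (A y).
Proof. by have /asboolP := sa_bopP A; exact. Qed.

Lemma saDE A B x : (A + B) x = A x + B x. Proof. by []. Qed.
Lemma saNE A x : (- A) x = - A x. Proof. by []. Qed.
Lemma saZE (r : R) A x : (r *: A) x = (r%:C)%C *: A x. Proof. by []. Qed.
Lemma sa0E x : (0 : bop_sa H) x = 0. Proof. by []. Qed.

Lemma saZ A a x : A (a *: x) = a *: A x. Proof. exact: linearZ. Qed.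
Lemma saD A x y : A (x + y) = A x + A y. Proof. exact: linearD. Qed.
Lemma saB A x y : A (x - y) = A x - A y. Proof. exact: linearB. Qed.

Lemma sa_le A x : hnorm (A x) <= `|A| * hnorm x.
Proof. exact: (bop_le A x). Qed.
Lemma sa_norm_le A M :
  0 <= M -> (forall x, hnorm (A x) <= M * hnorm x) -> `|A| <= M.
Proof. exact: (@bop_norm_le _ _ A). Qed.

Lemma pj_subproof x : rank1 x x \in @self_adjoint R H.
Proof.
by apply/asboolP => y z; rewrite /= !innerE -innerC mulrC.
Qed.
Definition pj x : bop_sa H := MkBopSa (pj_subproof x).
Lemma pjE x z : pj x z = inner z x *: x. Proof. by []. Qed.

Lemma sym2_subproof x y : rank1 x y + rank1 y x \in @self_adjoint R H.
Proof.
apply/asboolP => u v; rewrite !bopDE /= !innerE -!innerC; ring.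
Qed.
Definition sym2 x y : bop_sa H := MkBopSa (sym2_subproof x y).
Lemma sym2E x y z : sym2 x y z = inner z y *: x + inner z x *: y.
Proof. by []. Qed.

Lemma pj_norm x : `|pj x| <= hnorm x ^+ 2.
Proof. by apply: sa_norm_le => [|z]; rewrite ?exprn_ge0 ?hnorm_ge0// rank1_bound. Qed.

Lemma sym2_norm x y : `|sym2 x y| <= 2 * hnorm x * hnorm y.
Proof.
apply: sa_norm_le => [|z]; first by rewrite !mulr_ge0 ?hnorm_ge0.
rewrite sym2E (le_trans (ler_hnormD _ _))//.
have := lerD (rank1_bound x y z) (rank1_bound y x z); move/le_trans; apply.
by rewrite le_eqVlt; apply/orP; left; apply/eqP; ring.
Qed.

Lemma sym2Dl x y z : sym2 (x + y) z = sym2 x z + sym2 y z.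
Proof.
by apply: saP => u; rewrite saDE !sym2E; apply: inner_ext => v; rewrite !innerE; ring.
Qed.

Lemma sym2Zl (r : R) x y : sym2 ((r%:C)%C *: x) y = r *: sym2 x y.
Proof.
apply: saP => u; rewrite saZE !sym2E; apply: inner_ext => v.
by rewrite !innerE conj_real; ring.
Qed.

Lemma jordanE A B x : jordan A B x = ((2^-1)%:C)%C *: (A (B x) + B (A x)).
Proof. by []. Qed.

(** The product A B A, written through [jordan] alone so that Jordan automorphisms preserve it. *)
Definition triple A B : bop_sa H :=
  2 *: jordan A (jordan A B) - jordan (jordan A A) B.

Lemma tripleE A B x : triple A B x = A (B (A x)).
Proof.
rewrite saDE saNE saZE !jordanE !(saD, saZ).
apply: inner_ext => z; rewrite !innerE fmorphV /= rmorph_nat.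
by field.
Qed.

Lemma pj_triple x A : triple (pj x) A = complex.Re (inner (A x) x) *: pj x.
Proof.
have r : inner (A x) x \is Num.real.
  by rewrite CrealE -innerC sa_inner.
by apply: saP => z; rewrite tripleE saZE !pjE linearZ /= !innerE RRe_real// scalerA mulrC.
Qed.
End SelfAdjoint.

(** Expanding B(u+v, u+v) = 0 gives B(u,v) = - B(v,u); for u = ix and v = y this makes i B(x,y) its
    own negative. *)
Lemma polarization (R : realType) (H : hilbertType R) (B : H -> H -> R[i]) :
  (forall x y z, B (x + y) z = B x z + B y z) ->
  (forall x y z, B x (y + z) = B x y + B x z) ->
  (forall x y, B ('i *: x) y = 'i * B x y) ->
  (forall x y, B x ('i *: y) = - 'i * B x y) ->
  (forall x, B x x = 0) -> forall x y, B x y = 0.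
Proof.
move=> BDl BDr BZl BZr B0 x y.
have S u v : B u v = - B v u.
  have /eqP := B0 (u + v); rewrite BDl !BDr !B0 add0r addr0 addr_eq0.
  by move=> /eqP.
have : (2 * 'i) * B x y = 0.
  have := S ('i *: x) y; rewrite BZl BZr => E.
  transitivity ('i * B x y + 'i * B x y); first by ring.
  by rewrite {1}E S; ring.
by move=> /eqP; rewrite !mulf_eq0 pnatr_eq0/= (negPf (neq0Ci _)) => /eqP.
Qed.

(** * The complex-linear operator T attached to a real-linear map *)

Section Intertwiner.
Context {R : realType} {H : hilbertType R}.
Local Notation V := (bop_sa H).
Implicit Types (alpha : {linear V -> V}) (e x : H).

(* If [alpha] is conjugation by [u], this is [<e, u e> *: u x]: it is the value
   at [e] of the complex-linear extension of [alpha] at [rank1 x e]. *)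
Definition intertwiner (alpha : V -> V) e x : H :=
  ((2^-1)%:C)%C *: (alpha (sym2 x e) e - 'i *: alpha (sym2 ('i *: x) e) e).

(** Real linearity comes from [alpha]; replacing x by ix exchanges the two terms up to the factor
    i. *)
Lemma intertwiner_linear alpha e : linear (intertwiner alpha e).
Proof.
have aD A B : alpha (A + B) = alpha A + alpha B by exact: linearD.
have aZ r A : alpha (r *: A) = r *: alpha A by exact: linearZ.
pose T := intertwiner alpha e.
have TD x y : T (x + y) = T x + T y.
  rewrite /T /intertwiner (scalerDr 'i) !sym2Dl !aD !saDE; apply: inner_ext => u.
  by rewrite !innerE; ring.
have TZ (r : R) x : T ((r%:C)%C *: x) = (r%:C)%C *: T x.
  rewrite /T /intertwiner scalerA (mulrC 'i) -scalerA !sym2Zl !aZ !saZE; apply: inner_ext => u.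
  by rewrite !innerE; ring.
have Ti x : T ('i *: x) = 'i *: T x.
  have i2 : ('i : R[i]) * 'i = -1 by rewrite -expr2; exact: sqrCi.
  rewrite /T /intertwiner scalerA i2 (_ : -1 = ((-1)%:C)%C); last by rewrite rmorphN1.
  rewrite sym2Zl aZ saZE rmorphN1; apply: inner_ext => u.
  rewrite !innerE; set p := inner _ _; set q := inner _ _.
  transitivity ((2^-1)%:C%C * ('i * q - 'i * 'i * p)); last by ring.
  by rewrite i2; ring.
move=> t x y; rewrite -/T TD; congr (_ + _).
rewrite [t]Crect -(RRe_real (Creal_Re t)) -(RRe_real (Creal_Im t)).
by rewrite !scalerDl TD TZ -!scalerA Ti TZ.
Qed.

Lemma intertwiner_bound (alpha : V -> V) e M : inner e e = 1 -> 0 <= M ->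
  (forall A, `|alpha A| <= M * `|A|) ->
  forall x, hnorm (intertwiner alpha e x) <= (2 * M) * hnorm x.
Proof.
move=> e1 M0 aM.
have b x : hnorm (alpha (sym2 x e) e) <= 2 * M * hnorm x.
  rewrite (le_trans (sa_le _ _))// (hnorm_unit e1) mulr1 (le_trans (aM _))//.
  have := sym2_norm x e; rewrite (hnorm_unit e1) mulr1 => Sx.
  by rewrite [2 * M]mulrC -mulrA ler_wpM2l.
move=> x; rewrite hnormZ ger0_norm ?invr_ge0// ler_pdivrMl//.
rewrite (le_trans (ler_hnormD _ _))// hnormN hnormZ1 ?normCi//.
by rewrite [leRHS]mulr_natl [leRHS]mulr2n lerD// (le_trans (b _))// hnormZ1 ?normCi.
Qed.

(** S_x e = x + <e,x> e, and the second term cancels because <e,x> is conjugate-linear in x. This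
    yields s(k0) = 1. *)
Lemma intertwiner_id e x : inner e e = 1 -> intertwiner id e x = x.
Proof.
move=> e1; rewrite /intertwiner !sym2E e1.
apply: inner_ext => u; rewrite !innerE conjCi fmorphV rmorph_nat.
have i2 : ('i : R[i]) * 'i = -1 by rewrite -expr2; exact: sqrCi.
set p := inner _ _; set q := inner _ _; set s := inner _ _.
transitivity (2^-1 * (p * (1 - 'i * 'i) + q * s * (1 + 'i * 'i))); first by ring.
by rewrite i2 subrr mulr0 addr0 opprK; field.
Qed.
End Intertwiner.

(** * Images of rank-one operators under a Jordan automorphism near the identity *)

Section JordanAutomorphism.
Context {R : realType} {H : hilbertType R}.
Local Notation V := (bop_sa H).
Variables (alpha : {linear V -> V}) (beta : V -> V) (e : H).
Hypothesis alphaJ : forall A B, alpha (jordan A B) = jordan (alpha A) (alpha B).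
Hypothesis alphaK : cancel alpha beta.
Hypothesis betaK : cancel beta alpha.
Hypothesis e1 : inner e e = 1.
Hypothesis alpha_close : forall A, `|alpha A - A| <= 8^-1 * `|A|.

Let Q := alpha (pj e).
Let g := Q e.
Let c := inner g g.
Let a x := alpha (sym2 x e).
Let w x := a x g.

Lemma alpha_triple A B : alpha (triple A B) = triple (alpha A) (alpha B).
Proof. by rewrite linearB linearZ /= !alphaJ. Qed.

Lemma Q_idem v : Q (Q v) = Q v.
Proof.
have PP : jordan (pj e) (pj e) = pj e.
  apply: saP => z; rewrite jordanE !pjE; apply: inner_ext => y.
  by rewrite !innerE e1 fmorphV /= rmorph_nat; field.
have := congr1 (fun A : V => alpha A v) PP; rewrite alphaJ jordanE -/Q => {2}<-.
by apply: inner_ext => y; rewrite !innerE fmorphV /= rmorph_nat; field.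
Qed.

Lemma QgE : Q g = g. Proof. exact: Q_idem. Qed.

(** <Qe,e> = <QQe,e> = <Qe,Qe>. Thus the normalization <g,g> is the value of a functional linear in
    [alpha]. *)
Lemma inner_g_e : inner g e = c.
Proof. by rewrite /c {2}/g -sa_inner QgE. Qed.

Lemma g_close : hnorm (g - e) <= 8^-1.
Proof.
have -> : g - e = (Q - pj e) e by rewrite saDE saNE pjE e1 scale1r.
rewrite (le_trans (sa_le _ _))// (hnorm_unit e1) mulr1 (le_trans (alpha_close _))//.
by rewrite ler_piMr// (le_trans (pj_norm e))// (hnorm_unit e1) expr1n.
Qed.

Lemma c_neq0 : c != 0.
Proof.
apply/eqP => /inner_eq0 g0; have := g_close.
by rewrite g0 sub0r hnormN (hnorm_unit e1); lra.
Qed.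

Lemma conj_c : c^* = c. Proof. exact: conj_innerxx. Qed.

(** Transporting [pj_triple] at e for the operator [beta (pj g)] gives Q |g><g| Q = r Q; the left
    side is |g><g| because Q g = g, and evaluation at g gives r = c. *)
Lemma alpha_pj_base v : Q v = (inner v g / c) *: g.
Proof.
have [r rE] : exists r : R, forall v, inner v g *: g = (r%:C)%C *: Q v.
  exists (complex.Re (inner (beta (pj g) e) e)) => u.
  rewrite -saZE /Q -[_ *: alpha _]linearZ -pj_triple alpha_triple betaK tripleE.
  by rewrite -/Q pjE saZ QgE sa_inner QgE.
have cr : c = (r%:C)%C.
  have := congr1 (fun z => inner z g) (rE g).
  by rewrite QgE !innerE => /(mulIf c_neq0).
by rewrite mulrC -scalerA rE scalerA -cr mulVf ?scale1r// c_neq0.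
Qed.

(** * Vectors orthogonal to e *)

Section Perp.
Variable x : H.
Hypothesis xe : inner x e = 0.

Lemma sym2_e : sym2 x e e = x.
Proof. by rewrite sym2E e1 (innerC e x) xe conjC0 scale0r addr0 scale1r. Qed.

(** The Jordan product of P and S_x is S_x / 2, hence alpha(S_x) = Q alpha(S_x) + alpha(S_x) Q,
    where Q is known to have rank one. *)
Lemma alpha_sym2_perp v : a x v = (inner v (w x) / c) *: g + (inner v g / c) *: w x.
Proof.
have J : jordan (pj e) (sym2 x e) = 2^-1 *: sym2 x e.
  apply: saP => z; rewrite jordanE saZE; congr (_ *: _).
  rewrite !(pjE, sym2E); apply: inner_ext => y.
  by rewrite !innerE e1 (innerC e x) xe conjC0; ring.
have : alpha (jordan (pj e) (sym2 x e)) v = alpha (2^-1 *: sym2 x e) v by rewrite J.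
rewrite alphaJ jordanE linearZ saZE.
rewrite -/Q -/(a x) => /scalerI <-; last by rewrite fmorphV invr_eq0 /= rmorph_nat pnatr_eq0.
by rewrite !alpha_pj_base sa_inner saZ.
Qed.

(** Transport of |x><x| = S_x P S_x. *)
Lemma alpha_pj_perp v : alpha (pj x) v = (inner v (w x) / c) *: w x.
Proof.
have -> : pj x = triple (sym2 x e) (pj e).
  by apply: saP => z; rewrite tripleE !pjE saZ sym2_e sa_inner sym2_e.
by rewrite alpha_triple tripleE -/Q alpha_pj_base saZ sa_inner.
Qed.

(** Serves to show that w(x) is nonzero and to exclude w(ix) = - i w(x). *)
Lemma w_close : x != 0 -> hnorm (w x - x) < hnorm x.
Proof.
move=> x0; have nx : 0 < hnorm x.
  by rewrite lt_neqAle hnorm_ge0 andbT eq_sym; apply: contraNneq x0 => /hnorm_eq0 ->.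
have gc := g_close.
have g2 : hnorm g <= 9 / 8.
  rewrite -[g](subrK e) (le_trans (ler_hnormD _ _))// (hnorm_unit e1); lra.
have -> : w x - x = (a x - sym2 x e) g + sym2 x e (g - e).
  by rewrite saDE saNE saB sym2_e subrKA.
have S2 := sym2_norm x e; rewrite (hnorm_unit e1) mulr1 in S2.
have b1 := le_trans (sa_le _ _) (ler_pM (normr_ge0 _) (hnorm_ge0 g)
  (le_trans (alpha_close (sym2 x e)) (ler_wpM2l _ S2)) g2).
have b2 := le_trans (sa_le _ _) (ler_pM (normr_ge0 (sym2 x e)) (hnorm_ge0 _) S2 gc).
apply: (le_lt_trans (ler_hnormD _ _)).
apply: (le_lt_trans (lerD (b1 _) b2)); first by rewrite invr_ge0.
(* The total is 2/8 * 9/8 + 2/8 = 17/32 times |x|. *)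
lra.
Qed.
End Perp.

Lemma wD x y : w (x + y) = w x + w y.
Proof. by rewrite /w -saDE /a -linearD -sym2Dl. Qed.

Lemma w_imaginary x : inner x e = 0 -> w ('i *: x) = 'i *: w x.
Proof.
move=> xe; have [->|x0] := eqVneq x 0.
  have w0 : w 0 = 0 by apply: (addrI (w 0)); rewrite -wD !addr0.
  by rewrite scaler0 w0 scaler0.
set y := 'i *: x; have ye : inner y e = 0 by rewrite innerZl xe mulr0.
have xye : inner (x + y) e = 0 by rewrite innerDl xe ye addr0.
have i2 : ('i : R[i]) ^+ 2 = -1 by exact: sqrCi.
have ic : ('i : R[i])^* = - 'i by exact: conjCi.
have cn0 := c_neq0.
have cK s : c * (s / c) = s by rewrite mulrC divfK.
have cK2 s t : c * (s / c * t) = s * t by rewrite mulrA cK.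
(* From |ix><ix| = |x><x|. *)
have F1 v : inner v (w y) *: w y = inner v (w x) *: w x.
  have : alpha (pj y) v = alpha (pj x) v.
    congr (alpha _ _); apply: saP => z; rewrite !pjE; apply: inner_ext => u.
    rewrite !innerE ic; transitivity (- 'i ^+2 * inner z x * inner x u); first by ring.
    by rewrite i2 opprK mul1r.
  rewrite !alpha_pj_perp// => /(congr1 (fun z => c *: z)).
  by rewrite !scalerA !cK.
(* From |x+ix><x+ix| = 2 |x><x|: the diagonal terms cancel by [F1], leaving the cross terms. *)
have F2 v : inner v (w y) *: w x + inner v (w x) *: w y = 0.
  have : alpha (pj (x + y)) v = alpha (2 *: pj x) v.
    congr (alpha _ _); apply: saP => z; rewrite saZE !pjE; apply: inner_ext => u.
    rewrite !innerE ic rmorph_nat.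
    transitivity ((1 - 'i ^+2) * inner z x * inner x u); first by ring.
    by rewrite i2 opprK mulrA.
  rewrite linearZ saZE !alpha_pj_perp// wD => E; apply: inner_ext => u.
  have := congr1 (fun z => c * inner z u) E.
  have := congr1 (inner^~ u) (F1 v).
  rewrite !innerE rmorph_nat [c * (2 * _)]mulrCA !cK2 => E1 E2.
  apply: (addrI (inner v (w y) * inner (w y) u + inner v (w x) * inner (w x) u)).
  by rewrite [in RHS]E1 addr0 -[RHS]mulr2n -mulr_natl -E2; ring.
set n := inner (w x) (w x); set m := inner (w y) (w x).
have wx0 : w x != 0.
  apply: contraTneq (w_close xe x0) => ->.
  by rewrite sub0r hnormN ltxx.
have n0 : n != 0 by apply: contra_neq wx0 => /inner_eq0.
have mE : inner (w x) (w y) = - m.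
  apply: (mulIf n0); have := congr1 (inner^~ (w x)) (F2 (w x)).
  by rewrite !innerE -/n -/m => /eqP; rewrite addr_eq0 => /eqP ->; ring.
have wyE : n *: w y = m *: w x.
  by have /eqP := F2 (w x); rewrite mE scaleNr addrC subr_eq0 => /eqP.
(* [F1] gives - m^2 = n^2, so that w(ix) is i or - i times w(x). *)
have : (m - 'i * n) * (m + 'i * n) = 0.
  have := congr1 (inner^~ (w x)) (F1 (w x)); rewrite !innerE mE -/n -/m => E.
  by transitivity (- (- m * m) - 'i ^+2 * (n * n)); [ring|rewrite E i2; ring].
move=> /eqP; rewrite mulf_eq0 => /orP[|] /eqP.
  move=> /subr0_eq mi; apply: (scalerI n0).
  by rewrite wyE mi scalerA mulrC.
move=> /eqP; rewrite addr_eq0 => /eqP mi; exfalso.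
have wyx : w y = - 'i *: w x.
  by apply: (scalerI n0); rewrite wyE mi scalerA mulrN mulrC.
have y0 : y != 0 by rewrite scaler_eq0 negb_or neq0Ci.
have hy : hnorm y = hnorm x by rewrite hnormZ1// normCi.
have cx := w_close xe x0; have cy := w_close ye y0.
(* If w(ix) = - i w(x), then - i (w(x) - x) - (w(ix) - ix) = 2ix, although both differences have
   norm below |x|. *)
have : 2 * hnorm x <= hnorm (w x - x) + hnorm (w y - y).
  have -> : hnorm (w x - x) = hnorm (- 'i *: (w x - x)) by rewrite hnormZ1// normrN normCi.
  rewrite -[hnorm (w y - y)]hnormN.
  apply: le_trans (ler_hnormD _ _).
  rewrite wyx (_ : _ + _ = (2%:C)%C *: y).
    by rewrite hnormZ hy gtr0_norm.
  by apply: inner_ext => u; rewrite /y !innerE rmorph_nat; ring.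
apply/negP; rewrite -ltNge mulr_natl mulr2n ltrD//.
by rewrite -hy.
Qed.

(** * T as a scaled unitary implementing [alpha] *)

Let alphaD A B : alpha (A + B) = alpha A + alpha B. Proof. exact: linearD. Qed.
Let alphaZ r A : alpha (r *: A) = r *: alpha A. Proof. exact: linearZ. Qed.
Let alpha0 : alpha 0 = 0. Proof. exact: linear0. Qed.

Let T := intertwiner alpha e.

Let T_linear : linear T. Proof. exact: intertwiner_linear. Qed.

Let TD x y : T (x + y) = T x + T y.
Proof. by rewrite -[x]scale1r T_linear !scale1r. Qed.
Let T0 : T 0 = 0. Proof. by apply: (addrI (T 0)); rewrite -TD !addr0. Qed.
Let TZ t x : T (t *: x) = t *: T x.
Proof. by rewrite -[t *: x]addr0 T_linear T0 !addr0. Qed.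

(** As <e,g> = c, alpha(S_x) e = (<e, w x> / c) g + w x. The first coefficient is conjugate-linear
    in x by [w_imaginary] and cancels; the second term is complex-linear and survives. *)
Lemma intertwiner_perp x : inner x e = 0 -> T x = w x.
Proof.
move=> xe; have ixe : inner ('i *: x) e = 0 by rewrite innerZl xe mulr0.
rewrite /T /intertwiner -/(a x) -/(a ('i *: x)) !alpha_sym2_perp// w_imaginary//.
rewrite (innerC e g) inner_g_e conj_c divff ?c_neq0//.
apply: inner_ext => u; rewrite !innerE conjCi fmorphV rmorph_nat.
have i2 : ('i : R[i]) * 'i = -1 by rewrite -expr2; exact: sqrCi.
set p := inner _ _; set q := inner _ _; set s := inner _ _.
transitivity (2^-1 * (p / c * q * (1 + 'i * 'i) + s * (1 - 'i * 'i))); first by ring.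
by rewrite i2 subrr mulr0 add0r opprK; field.
Qed.

(** S_e = 2P and S_{ie} = 0. *)
Lemma intertwiner_base : T e = g.
Proof.
have -> : T e = 2^-1 *: (2 *: g - 0).
  rewrite /T /intertwiner fmorphV rmorph_nat; congr (_ *: (_ - _)).
    have -> : sym2 e e = 2 *: pj e.
      apply: saP => z; rewrite saZE sym2E pjE rmorph_nat.
      by apply: inner_ext => u; rewrite !innerE; ring.
    by rewrite alphaZ saZE rmorph_nat.
  have -> : sym2 ('i *: e) e = 0.
    apply: saP => z; rewrite sa0E sym2E.
    by apply: inner_ext => u; rewrite !innerE conjCi; ring.
  by rewrite alpha0 sa0E scaler0.
by rewrite subr0 scalerA mulVf ?scale1r// pnatr_eq0.
Qed.

Lemma perp_decomp x : {t : R[i] & {y | inner y e = 0 & x = t *: e + y}}.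
Proof.
exists (inner x e), (x - inner x e *: e); last by rewrite addrC subrK.
by rewrite !innerE e1; ring.
Qed.

Lemma alpha_pj x v : alpha (pj x) v = (inner v (T x) / c) *: T x.
Proof.
have [t [y ye ->]] := perp_decomp x.
have tye : inner (t^* *: y) e = 0 by rewrite innerZl ye mulr0.
(* The cross terms of |te+y><te+y| form S at the vector y scaled by the conjugate of t, so the
   formulas for P, S and |y><y| apply. *)
have -> : pj (t *: e + y) =
    complex.Re (t * t^*) *: pj e + sym2 (t^* *: y) e + pj y.
  apply: saP => z; rewrite !saDE saZE sym2E !pjE RRe_real; last first.
    by apply: ger0_real; rewrite -normCK exprn_ge0.
  by apply: inner_ext => u; rewrite !innerE conjCK; ring.
rewrite !alphaD alphaZ !saDE saZE (alpha_pj_perp ye) -/(a (t^* *: y)).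
rewrite alpha_sym2_perp// -(intertwiner_perp tye) -(intertwiner_perp ye) -/Q.
rewrite alpha_pj_base TD !TZ intertwiner_base RRe_real; last by apply: ger0_real; rewrite -normCK exprn_ge0.
by apply: inner_ext => u; rewrite !innerE conjCK; ring.
Qed.

Lemma intertwiner_eq0 x : T x = 0 -> x = 0.
Proof.
move=> Tx0; have p0 : pj x = 0.
  apply: (can_inj alphaK); apply: saP => v.
  by rewrite alpha0 alpha_pj Tx0 scaler0.
have := congr1 (fun A : V => inner (A x) x) p0.
rewrite sa0E pjE innerZl inner0l => /eqP; rewrite mulf_eq0 orbb => /eqP.
exact: inner_eq0.
Qed.

(** Transport of |x><x| A |x><x| = <Ax,x> |x><x|, evaluated at T x and paired with T x; the factors
    <Tx,Tx> cancel since T is injective. *)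
Lemma intertwiner_quadratic A x : inner (alpha A (T x)) (T x) = c * inner (A x) x.
Proof.
have [->|x0] := eqVneq x 0; first by rewrite T0 !inner0r mulr0.
have n0 : inner (T x) (T x) != 0.
  by apply: contra_neq x0 => /inner_eq0 /intertwiner_eq0.
have r : inner (A x) x \is Num.real by rewrite CrealE -innerC sa_inner.
have := congr1 (fun B : V => inner (alpha B (T x)) (T x)) (pj_triple x A).
rewrite alpha_triple tripleE alphaZ saZE RRe_real// !alpha_pj saZ.
rewrite (innerZl (inner (A x) x)) !(innerZl (_ / _)) => E.
have cn0 := c_neq0.
apply: (mulIf n0); apply: (mulIf n0); apply: (@mulIf _ (c^-1 * c^-1)).
  by rewrite mulf_neq0// invr_neq0.
set p := inner (alpha _ _) _ in E *; set q := inner (A x) x in E *.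
set s := inner (T x) _ in E *.
by transitivity (s / c * p / c * s); [ring|rewrite E; field].
Qed.

Lemma intertwiner_form A x y : inner (alpha A (T x)) (T y) = c * inner (A x) y.
Proof.
apply/eqP; rewrite -subr_eq0; apply/eqP.
apply: (@polarization _ _ (fun x y => inner (alpha A (T x)) (T y) - c * inner (A x) y)).
- by move=> u v z; rewrite TD !saD !innerDl; ring.
- by move=> u v z; rewrite TD !innerDr; ring.
- by move=> u v; rewrite TZ !saZ !(innerZl 'i); ring.
- by move=> u v; rewrite TZ !(innerZr 'i) conjCi; ring.
- by move=> u; rewrite intertwiner_quadratic subrr.
Qed.

(** With I the identity, applying [alpha] to the Jordan product of I and [beta] I, which is [beta]
    I, shows that the Jordan product of [alpha] I and I is I. *)
Lemma alpha_id (A1 : V) v : (forall v, A1 v = v) -> alpha A1 v = v.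
Proof.
move=> A1E; have J : jordan A1 (beta A1) = beta A1.
  apply: saP => z; rewrite jordanE !A1E; apply: inner_ext => u.
  by rewrite !innerE fmorphV rmorph_nat; field.
have := alphaJ A1 (beta A1); rewrite J betaK => /(congr1 (fun B : V => B v)).
rewrite jordanE !A1E => E.
by apply: inner_ext => u; rewrite [in RHS]E !innerE fmorphV rmorph_nat; field.
Qed.

Lemma intertwiner_isom x y : inner (T x) (T y) = c * inner x y.
Proof.
have id_sa : bop1 H \in @self_adjoint R H by apply/asboolP.
by rewrite -[in RHS](intertwiner_form (MkBopSa id_sa)) alpha_id.
Qed.

(** For y' orthogonal to g, the preimage A of |y'><g| + |g><y'| satisfies A = P A + A P because its
    image does so with Q. Hence A = S_z with z = A e orthogonal to e, and w(z) = c y'. *)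
Lemma intertwiner_surj y : exists x, T x = y.
Proof.
have cn0 := c_neq0.
have [t [y' y'g ->]] : exists t, exists2 y', inner y' g = 0 & y = t *: g + y'.
  exists (inner y g / c), (y - (inner y g / c) *: g); last by rewrite addrC subrK.
  by rewrite innerDl innerNl innerZl -/c divfK// subrr.
pose A := beta (sym2 y' g); pose z := A e.
have AE v : A v = pj e (A v) + A (pj e v).
  have : jordan (pj e) A = 2^-1 *: A.
    apply: (can_inj alphaK); rewrite alphaJ alphaZ betaK -/Q.
    apply: saP => u; rewrite jordanE saZE; congr (_ *: _).
    rewrite !alpha_pj_base !sym2E; apply: inner_ext => p.
    by rewrite !innerE (innerC g y') y'g conjC0 -/c; field.
  move=> /(congr1 (fun B : V => B v)); rewrite jordanE saZE.
  by move=> /scalerI ->//; rewrite fmorphV invr_eq0 rmorph_nat pnatr_eq0.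
have ze : inner z e = 0.
  have := AE e; rewrite !pjE saZ e1 scale1r -/z => /eqP.
  rewrite -subr_eq0 opprD addrCA subrr addr0 oppr_eq0 => /eqP/(congr1 (inner^~ e)).
  by rewrite innerZl e1 mulr1 inner0l.
have zE : sym2 z e = A.
  by apply: saP => v; rewrite AE !pjE saZ sym2E -/z (sa_inner A) addrC.
have wz : w z = c *: y'.
  by rewrite /w /a zE betaK sym2E (innerC g y') y'g conjC0 -/c scale0r addr0.
exists (t *: e + c^-1 *: z).
by rewrite TD !TZ intertwiner_base intertwiner_perp// wz scalerA mulVf// scale1r.
Qed.

Lemma intertwinerP A x : alpha A (T x) = T (A x).
Proof.
apply: inner_ext => u; have [y <-] := intertwiner_surj u.
by rewrite intertwiner_form intertwiner_isom.
Qed.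
End JordanAutomorphism.

(** * Adjoints, surjective isometries and conjugation *)

Section Unitary.
Context {R : realType} {H : hilbertType R}.

Lemma is_adjoint_unique (A B C : bop H) :
  is_adjoint A B -> is_adjoint A C -> B = C.
Proof.
move=> AB AC; apply: bopP => y; apply: inner_ext => x.
by rewrite innerC -AB AC -innerC.
Qed.

(** [adjoint] is a choice, so it is computed by exhibiting one adjoint and invoking uniqueness. *)
Lemma adjointE (A B : bop H) : is_adjoint A B -> adjoint A = B.
Proof.
move=> AB; apply: is_adjoint_unique (AB).
exact: (@getI _ (is_adjoint A) B).
Qed.

Lemma isometry_unitary (u : bop H) :
  (forall x y, inner (u x) (u y) = inner x y) -> (forall y, exists x, u x = y) ->
  unitary u /\ forall x, adjoint u (u x) = x.
Proof.
move=> u_isom u_surj.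
(* The inverse of u, which turns out to be its adjoint; surjectivity ensures that the default 0 is
   never taken. *)
pose v (y : H) : H := xget 0 [set x | u x = y].
have uv y : u (v y) = y by have := u_surj y => /(@xgetPex _ 0).
have u_inj x y : u x = u y -> x = y.
  by move=> uxy; apply: inner_ext => z; rewrite -u_isom uxy u_isom.
have vl : linear v.
  by move=> a x y; apply: u_inj; rewrite uv linearP /= !uv.
have v_bound y : hnorm (v y) <= 1 * hnorm y.
  rewrite mul1r -(@ler_pXn2r _ 2)// ?nnegrE ?hnorm_ge0// -lecR -!innerxx.
  by rewrite -u_isom !uv.
pose w : bop H := bounded_bop vl v_bound.
have vu x : v (u x) = x by apply: u_inj; rewrite uv.
have uw : adjoint u = w.
  by apply: adjointE => x y; rewrite -[in LHS](uv y) u_isom.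
by rewrite /unitary uw; split=> //; split; apply: bopP => x; [exact: uv|exact: vu].
Qed.

Lemma Ad_intertwined (u A B : bop H) :
  (forall x, adjoint u (u x) = x) -> (forall y, exists x, u x = y) ->
  (forall x, B (u x) = u (A x)) -> Ad u A = B.
Proof.
move=> uK u_surj uAB; apply: bopP => y; have [x <-] := u_surj y.
by rewrite uAB -[in RHS](uK x).
Qed.

Lemma exists_unit : infinite_dimensional H -> exists e : H, inner e e = 1.
Proof.
move=> Hinf; have [x x0] : exists x : H, x != 0.
  (* Without a nonzero vector the empty family would span H. *)
  apply: contra_notP Hinf => nx; exists 0, (fun=> 0) => x; exists (fun=> 0).
  rewrite big_ord0; apply/eqP; apply: contra_notT nx => x0; by exists x.
have nx : hnorm x != 0 by apply: contra_neq x0 => /hnorm_eq0.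
exists (((hnorm x)^-1%:C)%C *: x).
rewrite !innerE conj_real innerxx -!rmorphM /=.
by rewrite (_ : _ * _ = 1) ?rmorph1//; field.
Qed.
End Unitary.

(** * The cross-section as a function of k, with [h] standing for the inverse of k0 *)

Section CrossSection.
Context {R : realType} {H : hilbertType R}.
Local Notation V := (bop_sa H).
Variables (h : BL V V) (e : H).
Hypothesis e1 : inner e e = 1.
Implicit Types k : BL V V.

Lemma BL_comp_bound k A : `|(k \o h) A| <= `|k| * `|h| * `|A|.
Proof. by rewrite /= (le_trans (BL_le _ _))// -mulrA ler_wpM2l// BL_le. Qed.

Lemma expectation_le (A : V) : `|complex.Re (inner (A e) e)| <= `|A|.
Proof.
rewrite -lecR (le_trans (normc_ge_Re _))// (le_trans (CauchySchwarz _ _))//.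
rewrite -!hnormE -rmorphM lecR (hnorm_unit e1) mulr1.
by rewrite (le_trans (sa_le _ _))// (hnorm_unit e1) mulr1.
Qed.

Definition intertwiner_bop k : bop H :=
  bounded_bop (intertwiner_linear (k \o h) e)
    (intertwiner_bound e1 (mulr_ge0 (normr_ge0 k) (normr_ge0 h)) (BL_comp_bound k)).

Lemma intertwiner_bop_linear : linear intertwiner_bop.
Proof.
have E k x : intertwiner_bop k x = intertwiner (fun A => k (h A)) e x by [].
move=> r k k'; apply: bopP => x; rewrite bopDE bopZE !E /intertwiner !BLDE !BLZE !saDE !saZE.
by apply: inner_ext => u; rewrite !innerE; ring.
Qed.

Lemma intertwiner_bop_bound k : `|intertwiner_bop k| <= (2 * `|h|) * `|k|.
Proof.
apply: bop_norm_le => [|x]; first by rewrite !mulr_ge0.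
rewrite -mulrA [`|h| * _]mulrC.
exact: (intertwiner_bound e1 (mulr_ge0 (normr_ge0 k) (normr_ge0 h)) (BL_comp_bound k)).
Qed.

Definition intertwiner_map : BL (BL V V) (bop H) :=
  MkBL (bounded_linearP intertwiner_bop_linear intertwiner_bop_bound).

Definition expectation k : R := complex.Re (inner (k (h (pj e)) e) e).

Lemma expectation_linear : linear expectation.
Proof.
move=> r k k'; rewrite /expectation BLDE BLZE saDE saZE !innerE raddfD /=.
by rewrite -[_%:C%C * _]/(_ *: _) /=; case: (inner _ _) => u v /=; rewrite mul0r subr0.
Qed.

Lemma expectation_bound k : `|expectation k| <= (`|h (pj e)|) * `|k|.
Proof. by rewrite (le_trans (expectation_le _))// mulrC BL_le. Qed.

Definition expectation_map : BL (BL V V) R :=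
  MkBL (bounded_linearP expectation_linear expectation_bound).

(** The summand 0 gives the expression the shape required by [is_Ck_powR_scale]. *)
Definition cross_section k : bop H :=
  expectation_map k `^ (- 2^-1) *: (intertwiner_map k + 0).
End CrossSection.

(** k h - 1 = (k - k0) h; the added 1 keeps the denominator of the radius positive. *)
Lemma near_bop_id (R : realType) (H : hilbertType R) (h k0 k : BL (bop_sa H) (bop_sa H)) :
  cancel h k0 -> `|k0 - k| < 8^-1 / (`|h| + 1) ->
  forall A, `|(k \o h) A - A| <= 8^-1 * `|A|.
Proof.
move=> hK kr A; have -> : (k \o h) A - A = - (k0 - k) (h A).
  by rewrite -[(k0 - k) _]/(k0 (h A) - k (h A)) hK opprB.
rewrite normrN (le_trans (BL_le _ _))//.
have h1 : 0 < `|h| + 1 by rewrite ltr_wpDl.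
apply: (@le_trans _ _ (8^-1 / (`|h| + 1) * ((`|h| + 1) * `|A|))).
  apply: ler_pM => //; first exact: ltW.
  by rewrite (le_trans (BL_le _ _))// ler_wpM2r// lerDl.
by rewrite mulrA divfK// gt_eqF.
Qed.

Lemma jordan_aut_comp (R : realType) (H : hilbertType R)
    (k k0 h : BL (bop_sa H) (bop_sa H)) :
  jordan_aut H k -> jordan_aut H k0 -> cancel k0 h -> cancel h k0 ->
  (exists b, cancel (k \o h) b /\ cancel b (k \o h)) /\
  forall A B, (k \o h) (jordan A B) = jordan ((k \o h) A) ((k \o h) B).
Proof.
move=> [[k' [kK k'K]] kJ] [_ k0J] k0K hK; split.
  exists (k0 \o k'); split=> A /=; first by rewrite kK hK.
  by rewrite k0K k'K.
move=> A B /=; rewrite -kJ; congr (k _).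
by apply: (can_inj k0K); rewrite k0J !hK.
Qed.

(** * The cross-section on a ball around k0 *)

Section CrossSectionTheory.
Context {R : realType} {H : hilbertType R}.
Local Notation V := (bop_sa H).
Variables (k0 h : BL V V) (e : H).
Hypotheses (e1 : inner e e = 1) (k0K : cancel k0 h) (hK : cancel h k0).
Hypothesis k0_aut : jordan_aut H k0.
Let r := 8^-1 / (`|h| + 1).

(** As |P| <= 1, the value lies within 1/8 of <Pe,e> = 1. *)
Lemma expectation_gt0 k : `|k0 - k| < r -> 0 < expectation_map h e1 k.
Proof.
move=> kr; have close := near_bop_id hK kr (pj e).
have := expectation_le e1 ((k \o h) (pj e) - pj e).
move=> /le_trans/(_ close)/le_trans/(_ (ler_wpM2l _ (pj_norm e))).
rewrite (hnorm_unit e1) expr1n mulr1 saDE saNE innerDl innerNl pjE e1 scale1r e1.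
rewrite raddfB /= -/(expectation h e k) invr_ge0 ler0n => /(_ isT).
rewrite ler_distl => /andP[+ _]; lra.
Qed.

Lemma cross_section_isom k : jordan_aut H k -> `|k0 - k| < r ->
  [/\ forall x y, inner (cross_section h e1 k x) (cross_section h e1 k y) = inner x y,
      forall y, exists x, cross_section h e1 k x = y
    & forall A x, (k \o h) A (cross_section h e1 k x) = cross_section h e1 k (A x)].
Proof.
move=> k_aut kr; have close := near_bop_id hK kr.
have [[b [bK Kb]] J] := jordan_aut_comp k_aut k0_aut k0K hK.
have p0 := expectation_gt0 kr.
set p := expectation_map h e1 k in p0 *.
set q := p `^ (- 2^-1).
have q0 : 0 < q by exact: powR_gt0.
have qp : q * q * p = 1.
  rewrite -[X in _ * X = _]powRr1 ?ltW// /q -!powRD ?(gt_eqF p0) ?implybT//.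
  by rewrite (_ : _ + _ = 0) ?powRr0//; field.
have sE x : cross_section h e1 k x = (q%:C)%C *: intertwiner (k \o h) e x.
  by rewrite /cross_section addr0 bopZE.
(* The factor c in [intertwiner_isom] is the expectation p, so q^2 p = 1 makes q T isometric. *)
have cE : inner ((k \o h) (pj e) e) ((k \o h) (pj e) e) = (p%:C)%C.
  rewrite -(inner_g_e J e1) RRe_real//.
  by rewrite (inner_g_e J e1) innerxx complex_real.
split=> [x y|y|A x].
- rewrite !sE !(innerZl q%:C%C, innerZr q%:C%C) conj_real (intertwiner_isom J bK Kb e1 close).
  by rewrite cE !mulrA -!rmorphM qp mul1r.
- have [x Tx] := intertwiner_surj J bK Kb e1 close ((q^-1%:C)%C *: y).
  by exists x; rewrite sE Tx scalerA -rmorphM mulfV ?gt_eqF// scale1r.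
- by rewrite !sE saZ (intertwinerP J bK Kb e1 close).
Qed.
End CrossSectionTheory.

Theorem theorem4p8 (R : realType) (H : hilbertType R)
    (Hinf : infinite_dimensional H) (Hsep : separable H)
    (k0 : BL (bop_sa H) (bop_sa H)) (hk0 : jordan_aut H k0) :
  exists (N : set (BL (bop_sa H) (bop_sa H)))
         (s : BL (bop_sa H) (bop_sa H) -> bop H),
    [/\ N k0 /\ relatively_open (jordan_aut H) N,
        smooth_on N s /\ (forall k, N k -> unitary (s k)),
        s k0 = bop1 H
      & forall k, N k -> forall A : bop_sa H, Ad (s k) (k0 A) = k A].
Proof.
have [e e1] := exists_unit Hinf; have [[h [k0K hK]] _] := hk0.
pose r := 8^-1 / (`|h| + 1).
have r0 : 0 < r by rewrite divr_gt0// ltr_wpDl.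
have in_ball k : ball k0 r k -> `|k0 - k| < r by rewrite -ball_normE.
exists (jordan_aut H `&` ball k0 r), (cross_section h e1).
have section k (Nk : (jordan_aut H `&` ball k0 r) k) :=
  cross_section_isom e1 k0K hK hk0 Nk.1 (in_ball _ Nk.2).
split.
- by split; [split=> //; exact: ballxx|exists (ball k0 r) => //; exact: ball_open].
- split=> [k Nk|k Nk].
    (* The formula makes sense on the whole ambient space, so it is its own smooth extension to the
       ball. *)
    exists (ball k0 r), (cross_section h e1); split=> //; first by case: Nk.
    split=> [|n]; first exact: ball_open.
    apply: is_Ck_powR_scale => k' /in_ball; exact: expectation_gt0.
  have [isom surj _] := section k Nk.
  by have [] := isometry_unitary isom surj.
- have k0h : k0 \o h = id by apply/funext => A; exact: hK.
  apply: bopP => x; rewrite /cross_section addr0 bopZE /= /expectation k0h.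
  rewrite -[k0 _]/((k0 \o h) _) k0h pjE e1 scale1r e1 powR1 scale1r.
  exact: intertwiner_id.
- move=> k Nk A; have [isom surj intertwines] := section k Nk.
  have [_ adjK] := isometry_unitary isom surj.
  apply: Ad_intertwined adjK surj _ => x.
  (* The intertwining relation for k h is used at the operator k0 A. *)
  have <- : k (h (k0 A)) = k A by rewrite k0K.
  exact: intertwines.
Qed.
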